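(* Let $G=(V,E)$ be a finite connected graph with positive edge rates $(r_e:e\in E)$ and let $\mathcal L$ be the generator of the single random walk $\mathrm{RW}(1)$. For every non-zero $f\in\mathbb R^V$ such that $\mathcal Lf=-\lambda f$ we have $$\log\left(\frac{\|f\|_2}{2\|f\|_1}\right)\le\frac{\lambda}{c_{\mathrm{LS}}}.$$
   Context: $\mathrm{RW}(1)$ is the continuous-time random walk on $V$ that jumps across each incident edge $e$ at rate $r_e$. $\pi$ is the uniform distribution on $V$ and $\|f\|_p^p=\sum_{x}\pi(x)|f(x)|^p$. $\mathcal E(h,h)=\langle-\mathcal Lh,h\rangle_\pi=\frac12\sum_{x,y}\pi(x)\mathcal L(x,y)(h(x)-h(y))^2$, where $\langle f,g\rangle_\pi=\sum_x\pi(x)f(x)g(x)$. The log-Sobolev constant is $$c_{\mathrm{LS}}:=\inf\left\{\frac{\mathcal E(h,h)}{\mathrm{Ent}_\pi(h^2)}:\ h^2\in(0,\infty)^V,\ \mathrm{Ent}_\pi(h^2)\neq0\right\},\qquad \mathrm{Ent}_\pi(g):=\mathbb E_\pi\bigl[g\log(g/\|g\|_1)\bigr].$$ *)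

(* Defs.v *)
From HB Require Import structures.
From mathcomp Require Import all_boot all_order all_algebra.
From mathcomp Require Import all_classical all_reals all_analysis.

Set Implicit Arguments.
Unset Strict Implicit.
Unset Printing Implicit Defensive.

Import Order.TTheory GRing.Theory Num.Theory.
Local Open Scope ring_scope.

(* An edge is the two-element set of its endpoints. *)

Definition simple_edges (V : finType) (E : {set {set V}}) : Prop :=
  forall e : {set V}, e \in E -> #|e| = 2%N.

Definition adjacent (V : finType) (E : {set {set V}}) : rel V :=
  fun x y => [set x; y]%SET \in E.

Definition connected_graph (V : finType) (E : {set {set V}}) : Prop :=
  (0 < #|V|)%N /\ forall x y : V, connect (adjacent E) x y.

Section RandomWalk.
Variables (R : realType) (V : finType).
Implicit Types (E : {set {set V}}) (r : {set V} -> R) (f g h : {ffun V -> R}).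

(* Only the values of r on the edges matter. *)
Definition generator E r f : {ffun V -> R} :=
  [ffun x => \sum_(y | adjacent E x y) r [set x; y]%SET * (f y - f x)].

Definition uniform_weight (x : V) : R := #|V|%:R^-1.

Definition expectation f : R := \sum_x uniform_weight x * f x.

Definition inner f g : R := \sum_x uniform_weight x * f x * g x.

Definition lp_norm (p : R) f : R :=
  (\sum_x uniform_weight x * `|f x| `^ p) `^ p^-1.

Definition dirichlet_form E r h : R := inner (- generator E r h) h.

Definition entropy g : R :=
  expectation [ffun x => g x * ln (g x / lp_norm 1 g)].

Definition square h : {ffun V -> R} := [ffun x => h x ^+ 2].

(* Extended-real valued, so that the infimum is +oo when V is a singleton and
   no h has nonzero entropy. *)
Definition log_sobolev_constant E r : \bar R :=
  ereal_inf [set q : \bar R | exists h : {ffun V -> R},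
    [/\ forall x, 0 < square h x,
        entropy (square h) != 0
      & q = (dirichlet_form E r h / entropy (square h))%:E]]%classic.

End RandomWalk.

(* Main.v *)
Require Import Defs.
From mathcomp Require Import all_boot all_order all_algebra.
From mathcomp Require Import all_classical all_reals all_analysis.
From mathcomp Require Import ring lra.

(** The idea is to test the log-Sobolev inequality on one explicit positive
function, [h = |f| + ||f||_1].

Jensen's inequality for the probability measure proportional to [h ^ 2]
bounds the entropy from below:
[2 ||h||_2 ^ 2 ln (||h||_2 / ||h||_1) <= Ent (h ^ 2)]
([entropy_square_ge]).  On the other hand [t |-> |t| + eps] is 1-Lipschitz, so
the Dirichlet form of [h] is at most that of [f] ([dirichlet_form_le]), which
is [lam ||f||_2 ^ 2] because [f] is an eigenfunction ([dirichlet_eigen]).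
Finally [||h||_2 >= ||f||_2], while [||h||_1 = 2 ||f||_1]: the shift, which
makes [h] strictly positive where [f] vanishes, costs the factor 2 in front of
[||f||_1].  When [a = ln (||f||_2 / (2 ||f||_1))] is positive these facts
combine to [c_LS <= lam / (2 a)] ([log_sobolev_le]), hence to
[a <= lam / (2 c_LS)] whenever [c_LS > 0].

The right-hand side is an extended real, so the degenerate cases need care.
If [a <= 0] the bound follows from [lam >= 0] and [c_LS >= 0].  If [c_LS = 0]
the quotient is infinite as soon as [lam > 0]; and if [lam = 0], connectedness
makes [f] constant, so that [||f||_2 = ||f||_1] and [a < 0]
([log_norm_ratio_harmonic_le0]). *)

Set Implicit Arguments.
Unset Strict Implicit.
Unset Printing Implicit Defensive.

Import Order.TTheory GRing.Theory Num.Theory.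
Local Open Scope ring_scope.

Section LogSobolev.
Variables (R : realType) (V : finType).
Implicit Types (E : {set {set V}}) (r : {set V} -> R) (f g h : {ffun V -> R}).

(** * Norms for the uniform distribution *)

Let w : R := #|V|%:R^-1.

Let w_ge0 : 0 <= w.
Proof. by rewrite /w invr_ge0 ler0n. Qed.

Lemma lp_norm1E f : lp_norm 1 f = \sum_x w * `|f x|.
Proof.
rewrite /lp_norm invr1 powRr1; last first.
  by apply: sumr_ge0 => x _; rewrite mulr_ge0 // powR_ge0.
by apply: eq_bigr => x _; rewrite powRr1.
Qed.

Lemma lp_norm2E f : lp_norm 2 f = Num.sqrt (inner f f).
Proof.
have -> : inner f f = \sum_x uniform_weight R x * `|f x| `^ 2.
  apply: eq_bigr => x _.
  by rewrite powR_mulrn // real_normK ?num_real // expr2 mulrA.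
rewrite /lp_norm powR12_sqrt //.
by apply: sumr_ge0 => x _; rewrite mulr_ge0 // powR_ge0.
Qed.

Lemma inner_ge0 f : 0 <= inner f f.
Proof. by apply: sumr_ge0 => x _; rewrite -mulrA mulr_ge0 // -expr2 sqr_ge0. Qed.

Lemma lp_norm1_square h : lp_norm 1 (square h) = inner h h.
Proof.
rewrite lp_norm1E; apply: eq_bigr => x _.
by rewrite ffunE ger0_norm ?sqr_ge0 // expr2 mulrA.
Qed.

Lemma sum_uniform_weight : (0 < #|V|)%N -> \sum_(x : V) w = 1.
Proof.
by move=> V0; rewrite sumr_const -mulr_natr mulVf // pnatr_eq0 -lt0n.
Qed.

Lemma ffun_neq0P f : f != 0 -> exists x, f x != 0.
Proof.
move=> f0; apply/existsP; apply: contraNT f0 => /existsPn f0.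
by apply/eqP/ffunP => x; rewrite ffunE; apply/eqP/negPn/f0.
Qed.

Lemma lp_norm1_gt0 f : f != 0 -> 0 < lp_norm 1 f.
Proof.
case/ffun_neq0P => x fx; have V0 : (0 < #|V|)%N by apply/card_gt0P; exists x.
rewrite lp_norm1E (bigD1 x) //= ltr_wpDr //.
  by apply: sumr_ge0 => y _; rewrite mulr_ge0.
by rewrite mulr_gt0 ?normr_gt0 // invr_gt0 ltr0n.
Qed.

Lemma inner_gt0 f : f != 0 -> 0 < inner f f.
Proof.
case/ffun_neq0P => x fx; have V0 : (0 < #|V|)%N by apply/card_gt0P; exists x.
rewrite /inner (bigD1 x) //= ltr_wpDr //.
  by apply: sumr_ge0 => y _; rewrite -mulrA mulr_ge0 // -expr2 sqr_ge0.
rewrite -mulrA -expr2 mulr_gt0 ?invr_gt0 ?ltr0n //.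
by rewrite exprn_even_gt0.
Qed.

Lemma ffun_pos_neq0 h : (0 < #|V|)%N -> (forall x, 0 < h x) -> h != 0.
Proof.
by case/card_gt0P => x _ h0; apply: contraTneq (h0 x) => ->; rewrite ffunE ltxx.
Qed.

(** The defect in this instance of the Cauchy-Schwarz inequality is the
variance of [h]. *)
Lemma sqr_lp_norm1_le h : (0 < #|V|)%N -> (forall x, 0 < h x) ->
  lp_norm 1 h ^+ 2 <= inner h h.
Proof.
move=> V0 h0; set m := lp_norm 1 h; rewrite -subr_ge0.
have mE : m = \sum_x w * h x.
  by rewrite /m lp_norm1E; apply: eq_bigr => x _; rewrite gtr0_norm.
have -> : inner h h - m ^+ 2 = \sum_x w * (h x - m) ^+ 2.
  transitivity (\sum_x (w * h x * h x - 2 * m * (w * h x) + m ^+ 2 * w)).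
    rewrite big_split sumrB /=.
    rewrite -[X in _ - X + _]mulr_sumr -mE -[X in _ = _ + X]mulr_sumr.
    by rewrite sum_uniform_weight // /inner /uniform_weight -/w; ring.
  by apply: eq_bigr => x _; ring.
by apply: sumr_ge0 => x _; rewrite mulr_ge0 // sqr_ge0.
Qed.

(** * Entropy bounds *)

(** Jensen's inequality for [-ln] under the probability density
[h ^ 2 / inner h h], in its elementary form: with [S = inner h h] and
[m = ||h||_1], apply the tangent bound [1 - 1 / t <= ln t] at [t = h x m / S],
where the left-hand sides average to zero. *)
Lemma entropy_square_ge h : (0 < #|V|)%N -> (forall x, 0 < h x) ->
  inner h h * ln (inner h h / lp_norm 1 h ^+ 2) <= entropy (square h).
Proof.
move=> V0 h0; rewrite /entropy /Defs.expectation lp_norm1_square.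
have h_neq0 := ffun_pos_neq0 V0 h0.
have m0 := lp_norm1_gt0 h_neq0; have S0 := inner_gt0 h_neq0.
have mE : lp_norm 1 h = \sum_x w * h x.
  by rewrite lp_norm1E; apply: eq_bigr => x _; rewrite gtr0_norm.
set m := lp_norm 1 h in m0 mE *.
have SE : inner h h = \sum_x w * h x ^+ 2.
  by apply: eq_bigr => x _; rewrite expr2 mulrA.
set S := inner h h in S0 SE *.
have tangent x : w * h x ^+ 2 * ln (S / m ^+ 2) + 2 * (w * h x ^+ 2 - S / m * (w * h x))
    <= w * (h x ^+ 2 * ln (h x ^+ 2 / S)).
  have hx := h0 x.
  have t0 : 0 < h x * m / S by rewrite divr_gt0 // mulr_gt0.
  have -> : h x ^+ 2 / S = S / m ^+ 2 * (h x * m / S) ^+ 2.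
    by field; rewrite !gt_eqF.
  rewrite [ln (_ * (_ ^+ 2))]lnM ?posrE; [|by rewrite divr_gt0 ?exprn_gt0|
    exact: exprn_gt0].
  rewrite lnXn //.
  have lnt : 1 - (h x * m / S)^-1 <= ln (h x * m / S).
    have ti0 : 0 < (h x * m / S)^-1 by rewrite invr_gt0.
    have := @le_ln1Dx R ((h x * m / S)^-1 - 1).
    rewrite addrCA subrr addr0 lnV ?posrE //.
    have -> : -1 < (h x * m / S)^-1 - 1 by lra.
    by move=> /(_ isT); lra.
  have -> : w * h x ^+ 2 - S / m * (w * h x)
      = w * h x ^+ 2 * (1 - (h x * m / S)^-1).
    by field; rewrite !gt_eqF.
  have a0 : 0 <= w * h x ^+ 2 by rewrite mulr_ge0 // sqr_ge0.
  have := ler_wpM2l a0 lnt.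
  rewrite mulrDr -!mulrA -mulr_natl; lra.
apply: (@le_trans _ _ (\sum_x w * (h x ^+ 2 * ln (h x ^+ 2 / S)))); last first.
  by apply: ler_sum => x _; rewrite !ffunE.
apply: le_trans (ler_sum _ (fun x _ => tangent x)).
rewrite big_split /= -mulr_suml -SE -mulr_sumr sumrB -SE -mulr_sumr -mE.
by rewrite divfK ?gt_eqF // subrr mulr0 addr0.
Qed.

(** The entropy depends on [h] through its square only, so [h] may be replaced
by its absolute value, to which the Jensen bound applies. *)
Lemma entropy_square_ge0 h : (0 < #|V|)%N -> (forall x, 0 < square h x) ->
  0 <= entropy (square h).
Proof.
move=> V0 h0; pose g : {ffun V -> R} := [ffun x => `|h x|].
have gh : square g = square h.
  by apply/ffunP => x; rewrite !ffunE real_normK ?num_real.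
have g0 x : 0 < g x.
  by have := h0 x; rewrite !ffunE normr_gt0 exprn_even_gt0.
rewrite -gh; apply: le_trans (entropy_square_ge V0 g0).
rewrite mulr_ge0 ?inner_ge0 // ln_ge0 //.
have m0 := lp_norm1_gt0 (ffun_pos_neq0 V0 g0).
by rewrite ler_pdivlMr ?exprn_gt0 // mul1r sqr_lp_norm1_le.
Qed.

(** * The Dirichlet form *)

(** Summation by parts: each edge contributes once from each endpoint. *)
Lemma dirichlet_formE E r h : dirichlet_form E r h =
  2^-1 * \sum_x \sum_(y | Defs.adjacent E x y)
    w * r [set x; y]%SET * (h x - h y) ^+ 2.
Proof.
pose A := \sum_x \sum_(y | Defs.adjacent E x y)
  w * r [set x; y]%SET * (h x - h y) * h x.
have AE : dirichlet_form E r h = A.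
  apply: eq_bigr => x _; rewrite !ffunE mulrN -mulNr -mulrA mulr_suml mulr_sumr.
  by apply: eq_bigr => y _; rewrite /uniform_weight -/w; ring.
(* An edge is an unordered pair, so relabelling its endpoints preserves both
   adjacency and the rate. *)
have AS : A = \sum_x \sum_(y | Defs.adjacent E x y)
    w * r [set x; y]%SET * (h y - h x) * h y.
  rewrite /A (exchange_big_dep xpredT) //=; apply: eq_bigr => x _.
  by apply: eq_big => [y|y _]; rewrite /Defs.adjacent finset.setUC.
have -> : \sum_x \sum_(y | Defs.adjacent E x y)
    w * r [set x; y]%SET * (h x - h y) ^+ 2 = A + A.
  rewrite {2}AS -big_split /=; apply: eq_bigr => x _.
  by rewrite -big_split /=; apply: eq_bigr => y _; ring.
by rewrite AE; field.
Qed.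

Section PositiveRates.
Variables (E : {set {set V}}) (r : {set V} -> R).
Hypothesis hr : forall e, e \in E -> 0 < r e.

Let edge_term_ge0 h x y : Defs.adjacent E x y ->
  0 <= w * r [set x; y]%SET * (h x - h y) ^+ 2.
Proof.
move=> xy; apply: mulr_ge0; last exact: sqr_ge0.
by apply: mulr_ge0 => //; exact/ltW/hr.
Qed.

Lemma dirichlet_form_ge0 h : 0 <= dirichlet_form E r h.
Proof.
rewrite dirichlet_formE mulr_ge0 ?invr_ge0 //; apply: sumr_ge0 => x _.
by apply: sumr_ge0 => y; exact: edge_term_ge0.
Qed.

Lemma dirichlet_form_le f h : (forall x y, `|h x - h y| <= `|f x - f y|) ->
  dirichlet_form E r h <= dirichlet_form E r f.
Proof.
move=> hf; rewrite !dirichlet_formE ler_wpM2l ?invr_ge0 //.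
apply: ler_sum => x _; apply: ler_sum => y xy.
rewrite ler_wpM2l //; first by apply: mulr_ge0 => //; exact/ltW/hr.
rewrite -[leLHS]real_normK ?num_real // -[leRHS]real_normK ?num_real //.
by rewrite lerXn2r ?nnegrE.
Qed.

Lemma dirichlet_form_eq0 f : connected_graph E ->
  dirichlet_form E r f = 0 -> forall x y, f x = f y.
Proof.
move=> [V0 con] D0.
have adj x y : Defs.adjacent E x y -> f x = f y.
  move=> xy; move/eqP: D0; rewrite dirichlet_formE mulf_eq0 invr_eq0.
  rewrite pnatr_eq0 /= psumr_eq0; last first.
    by move=> z _; apply: sumr_ge0 => t; exact: edge_term_ge0.
  move=> /allP/(_ x (mem_index_enum _)) /=.
  rewrite psumr_eq0; last by move=> t; exact: edge_term_ge0.
  move=> /allP/(_ y (mem_index_enum _)); rewrite xy /= !mulf_eq0.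
  rewrite invr_eq0 pnatr_eq0 -[_ == 0 :> nat]negbK -lt0n V0 /=.
  by rewrite (gt_eqF (hr xy)) /= orbb subr_eq0 => /eqP.
move=> x y; case/connectP: (con x y) => p; elim: p x => [|z p IH] x /=.
  by move=> _ ->.
by move=> /andP[/adj -> zp] yE; exact: IH.
Qed.

Lemma log_sobolev_constant_ge0 : (0 < #|V|)%N ->
  (0 <= log_sobolev_constant E r)%E.
Proof.
move=> V0; apply: le_ereal_inf_tmp => _ [h [h0 _ ->]].
by rewrite lee_fin divr_ge0 ?dirichlet_form_ge0 ?entropy_square_ge0.
Qed.

(** * Testing the constant on a shifted eigenfunction *)

Section Eigenfunction.
Variables (lam : R) (f : {ffun V -> R}).
Hypothesis f0 : f != 0.
Hypothesis eigen : generator E r f = (- lam) *: f.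

Lemma dirichlet_eigen : dirichlet_form E r f = lam * inner f f.
Proof.
rewrite /dirichlet_form eigen /inner mulr_sumr; apply: eq_bigr => x _.
by rewrite !ffunE /= /GRing.scale /=; ring.
Qed.

Let V0 : (0 < #|V|)%N.
Proof.
rewrite lt0n; apply: contraNneq f0 => /card0_eq V0.
by apply/eqP/ffunP => x; have := V0 x.
Qed.

Lemma eigenvalue_ge0 : 0 <= lam.
Proof.
by have := dirichlet_form_ge0 f; rewrite dirichlet_eigen pmulr_lge0 ?inner_gt0.
Qed.

(** The admissible functions are nowhere zero, hence the test function
[h = |f| + ||f||_1] in place of [|f|].  Its entropy is at least
[2 a ||f||_2 ^ 2], which is positive, and its Dirichlet form is at most
[lam ||f||_2 ^ 2]. *)
Lemma log_sobolev_le (a := ln (lp_norm 2 f / (2 * lp_norm 1 f))) : 0 < a ->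
  (log_sobolev_constant E r <= (lam / (2 * a))%:E)%E.
Proof.
move=> a0; have m0 := lp_norm1_gt0 f0.
pose h : {ffun V -> R} := [ffun x => `|f x| + lp_norm 1 f].
have h0 x : 0 < h x by rewrite ffunE ltr_wpDl.
have h1 : lp_norm 1 h = 2 * lp_norm 1 f.
  rewrite lp_norm1E.
  transitivity (\sum_x (w * `|f x| + w * lp_norm 1 f)).
    by apply: eq_bigr => x _; rewrite (gtr0_norm (h0 x)) ffunE mulrDr.
  by rewrite big_split /= -mulr_suml sum_uniform_weight // -lp_norm1E; ring.
have fh : inner f f <= inner h h.
  apply: ler_sum => x _; rewrite -!mulrA ler_wpM2l // -!expr2.
  rewrite -[leLHS]real_normK ?num_real // lerXn2r ?nnegrE ?(ltW (h0 x)) //.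
  by rewrite ffunE lerDl ltW.
have Dh : dirichlet_form E r h <= lam * inner f f.
  rewrite -dirichlet_eigen; apply: dirichlet_form_le => x y.
  rewrite !ffunE opprD addrACA subrr addr0.
  exact: ler_dist_dist.
have f20 : 0 < inner f f := inner_gt0 f0.
have aE : 2 * a = ln (inner f f / lp_norm 1 h ^+ 2).
  rewrite -(sqr_sqrtr (inner_ge0 f)) -lp_norm2E h1 -expr_div_n lnXn.
    by rewrite mulr_natl.
  apply: divr_gt0; first by rewrite lp_norm2E sqrtr_gt0.
  exact: mulr_gt0.
clearbody a.
have Ent : inner f f * (2 * a) <= entropy (square h).
  apply: le_trans (entropy_square_ge V0 h0).
  have h1_gt0 : 0 < lp_norm 1 h ^+ 2 by rewrite h1 exprn_gt0 // mulr_gt0.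
  have h2_gt0 : 0 < inner h h := lt_le_trans f20 fh.
  apply: ler_pM => //; [exact: ltW | exact/ltW/mulr_gt0 |].
  rewrite aE ler_ln ?posrE; [|exact: divr_gt0|exact: divr_gt0].
  by rewrite ler_pM2r ?invr_gt0.
have Ent0 : 0 < entropy (square h).
  by apply: lt_le_trans Ent; rewrite !mulr_gt0.
apply: (@le_trans _ _ (dirichlet_form E r h / entropy (square h))%:E).
  apply: ereal_inf_lbound; exists h; split=> //; last by rewrite gt_eqF.
  by move=> x; rewrite ffunE exprn_gt0.
rewrite lee_fin ler_pdivrMr // mulrAC ler_pdivlMr ?mulr_gt0 //.
apply: le_trans (ler_wpM2l eigenvalue_ge0 Ent).
by rewrite [leRHS]mulrA ler_pM2r ?mulr_gt0.
Qed.

(** An eigenfunction for the eigenvalue 0 has zero Dirichlet form, so on a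
connected graph it is constant; its two norms then agree and the ratio is
[1 / 2]. *)
Lemma log_norm_ratio_harmonic_le0 : connected_graph E -> lam = 0 ->
  ln (lp_norm 2 f / (2 * lp_norm 1 f)) <= 0.
Proof.
move=> con lam0; have m0 := lp_norm1_gt0 f0.
have cst : forall x y, f x = f y.
  by apply: dirichlet_form_eq0 con _; rewrite dirichlet_eigen lam0 mul0r.
case/card_gt0P: (V0) => x _.
have -> : lp_norm 2 f = lp_norm 1 f.
  rewrite lp_norm2E lp_norm1E.
  rewrite [RHS](eq_bigr (fun=> w * `|f x|)); last by move=> y _; rewrite (cst y x).
  rewrite -mulr_suml sum_uniform_weight // mul1r -sqrtr_sqr; congr Num.sqrt.
  rewrite /inner (eq_bigr (fun=> w * f x ^+ 2)).
    by rewrite -mulr_suml sum_uniform_weight // mul1r.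
  by move=> y _; rewrite (cst y x) expr2 mulrA.
rewrite ln_le0 // ler_pdivrMr ?mulr_gt0 //; lra.
Qed.

End Eigenfunction.
End PositiveRates.
End LogSobolev.

Theorem proposition1p5 (R : realType) (V : finType) (E : {set {set V}})
    (r : {set V} -> R)
    (hE : simple_edges E)
    (hconn : connected_graph E)
    (hr : forall e : {set V}, e \in E -> 0 < r e)
    (lam : R) (f : {ffun V -> R})
    (hf0 : f != 0)
    (hf : generator E r f = (- lam) *: f) :
  ((ln (lp_norm 2 f / (2 * lp_norm 1 f)))%:E
     <= lam%:E / log_sobolev_constant E r)%E.
Proof.
have lam0 := eigenvalue_ge0 hr hf0 hf.
have c0 := log_sobolev_constant_ge0 hr hconn.1.
set a := ln _; have [a_le0|a_gt0] := leP a 0.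
  by apply: (@le_trans _ _ 0%E); rewrite ?lee_fin // mule_ge0 ?lee_fin ?inve_ge0.
have := log_sobolev_le hr hf0 hf a_gt0; rewrite -/a.
case: (log_sobolev_constant E r) c0 => [c| |] //.
rewrite !lee_fin => c0 ca; have [c_eq0|c_neq0] := eqVneq c 0.
  have lam_gt0 : 0 < lam.
    rewrite lt0r lam0 andbT; apply: contraTneq a_gt0.
    by move/(log_norm_ratio_harmonic_le0 hr hf0 hf hconn); rewrite -leNgt.
  by rewrite c_eq0 inve0 gt0_muley ?lte_fin // leey.
have c_gt0 : 0 < c by rewrite lt0r c_neq0.
rewrite inver (negbTE c_neq0) -EFinM lee_fin ler_pdivlMr //.
move: ca; rewrite ler_pdivlMr ?mulr_gt0 // => ca.
have := mulr_gt0 a_gt0 c_gt0; lra.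
Qed.
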